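(* Let $q$ be a prime power and let $n,m,h$ be positive integers with $m\geq 3$ and $2\leq h\leq n-2$. Let $\mathbf{A}=(\alpha_1,\dots,\alpha_m)\in(\mathbb{F}_{q^n}^* )^m$ be such that $K_{\mathbf{A}}:=\alpha_1^{q^{m-1}}\alpha_2\alpha_3^{q}\cdots\alpha_m^{q^{m-2}}$ is not a $(1+q+\cdots+q^{m-1})$-th power in $\mathbb{F}_{q^n}$. Then the $\mathbb{F}_q$-subspace $$V_{\mathbf{A},h}:=\{(\underline{x},\underline{x}^q,\dots,\underline{x}^{q^{h-1}},f_1(\underline{x}),\dots,f_m(\underline{x})):\underline{x}\in\mathbb{F}_{q^n}^m\}\subseteq\mathbb{F}_{q^n}^{m(h+1)},$$ where $f_i(\underline{x})=x_i^{q^h}+\alpha_{i+1}x_{i+1}^{q^{h+1}}$ for $i=1,\dots,m-1$ and $f_m(\underline{x})=x_m^{q^h}+\alpha_1x_1^{q^{h+1}}$, is $(h+1,h+2)$-evasive.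
   Context: For $\underline{x}=(x_1,\dots,x_m)$, $\underline{x}^{q^j}=(x_1^{q^j},\dots,x_m^{q^j})$. Let $h'<k$ and $h'\leq r$ be positive integers. An $\mathbb{F}_q$-subspace $U\subseteq\mathbb{F}_{q^n}^k$ is $(h',r)$-evasive if for every $h'$-dimensional $\mathbb{F}_{q^n}$-subspace $H\subseteq\mathbb{F}_{q^n}^k$ one has $\dim_{\mathbb{F}_q}(U\cap H)\leq r$. *)

(* Defs.v *)
From HB Require Import structures.
From mathcomp Require Import all_boot all_algebra all_field.

Set Implicit Arguments.
Unset Strict Implicit.
Unset Printing Implicit Defensive.

Import GRing.Theory.
Local Open Scope ring_scope.

(* F is F_q with q = #|F|, and L is F_{q^n} with n = \dim {:L}.
   The space L^k is {ffun 'I_k -> L}. It is a vector space over F as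
   {ffun 'I_k -> L}, and over L as {ffun 'I_k -> L^o}: the two types are
   convertible, hence have the same vectors, but \dim counts over F in the
   first one and over L in the second one. *)

Section Evasive.
Variables (F : finFieldType) (L : fieldExtType F) (k : nat).
Implicit Types (U : {vspace {ffun 'I_k -> L}}).
Implicit Types (H : {vspace {ffun 'I_k -> L^o}}).

Definition projF H (v : {ffun 'I_k -> L}) : {ffun 'I_k -> L} := projv H v.

Fact projF_is_linear H : linear (projF H).
Proof.
have scaleE (b : F) (w : {ffun 'I_k -> L}) :
    b *: w = (b%:A : L) *: (w : {ffun 'I_k -> L^o}) :> {ffun 'I_k -> L^o}.
  apply/ffunP=> i; transitivity (b *: (w i : L)); first by rewrite ffunE.
  by rewrite [RHS]ffunE; symmetry; apply: (mulr_algl b (w i : L)).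
by move=> a u v; rewrite /projF !scaleE; apply: (linearP (projv H)).
Qed.

HB.instance Definition _ H :=
  GRing.isLinear.Build F {ffun 'I_k -> L} {ffun 'I_k -> L} _ (projF H)
    (projF_is_linear H).

(* Restriction of scalars: the L-subspace H seen as an F-subspace, obtained
   as the range of the projection onto H, which is also F-linear. *)
Definition restrict_scalars H : {vspace {ffun 'I_k -> L}} :=
  limg (linfun (projF H)).

Lemma mem_restrict_scalars H (v : {ffun 'I_k -> L}) :
  (v \in restrict_scalars H) = ((v : {ffun 'I_k -> L^o}) \in H).
Proof.
apply/memv_imgP/idP=> [[u _ ->]|Hv].
  by rewrite lfunE; apply: memv_proj.
by exists v; rewrite ?memvf // lfunE /= /projF projv_id.
Qed.

Definition evasive (h' r : nat) U : Prop :=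
  forall H, \dim H = h' -> (\dim (U :&: restrict_scalars H) <= r)%N.

End Evasive.

Section EvasiveSubspace.
Variables (F : finFieldType) (L : fieldExtType F) (m h : nat).
Variable A : 'I_m -> L.
Implicit Types (x : {ffun 'I_m -> L}).

(* Indices run from 0 to m - 1 and are taken cyclically (ordS, ord_pred). *)
Definition f_ x (i : 'I_m) : L :=
  x i ^+ (#|F| ^ h) + A (ordS i) * x (ordS i) ^+ (#|F| ^ h.+1).

(* mxvec lists the rows of a matrix one after the other: the coordinates are
   h.+1 consecutive blocks of length m. *)
Definition Vfun x : {ffun 'I_(h.+1 * m) -> L} :=
  [ffun t => mxvec (\matrix_(j < h.+1, i < m)
                      if (j < h)%N then x i ^+ (#|F| ^ j) else f_ x i) 0 t].

Fact Frobenius_linear j (a : F) (y z : L) :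
  (a *: y + z) ^+ (#|F| ^ j) = a *: y ^+ (#|F| ^ j) + z ^+ (#|F| ^ j).
Proof.
have [p p_pr charFp] := finPcharP F.
have charLp : p \in [pchar L] by rewrite (pchar_lalg L).
have charL : [pchar L].-nat (#|F| ^ j)%N.
  rewrite (card_pprimeChar charFp) -expnM pnatX; apply/orP; left.
  by rewrite (eq_pnat _ (pcharf_eq charLp)) pnat_id.
rewrite exprDn_pchar // exprZn; congr (_ *: _ + _).
by elim: j {charL} => [|j IHj]; rewrite ?expr1 // expnSr exprM IHj expf_card.
Qed.

Fact Vfun_is_linear : linear Vfun.
Proof.
move=> a x y; apply/ffunP=> t; rewrite !ffunE.
case/mxvec_indexP: t => j i; rewrite !mxvecE !mxE /f_ !ffunE.
case: ifP => _; first exact: Frobenius_linear.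
rewrite !Frobenius_linear mulrDr -scalerAr scalerDr -!addrA.
by congr (_ + _); rewrite addrCA.
Qed.

HB.instance Definition _ :=
  GRing.isLinear.Build F {ffun 'I_m -> L} {ffun 'I_(h.+1 * m) -> L} _ Vfun
    Vfun_is_linear.

Definition V_ : {vspace {ffun 'I_(h.+1 * m) -> L}} := limg (linfun Vfun).

Lemma mem_V v : (v \in V_) <-> exists x, v = Vfun x.
Proof.
split=> [/memv_imgP[x _ ->]|[x ->]]; first by exists x; rewrite lfunE.
by apply/memv_imgP; exists x; rewrite ?memvf // lfunE.
Qed.

(* ord_pred i is m - 1 for i = 0 and i - 1 otherwise: in the cyclic order
   starting at index 1, the exponents are 1, q, ..., q ^ (m - 1). *)
Definition K_ : L := \prod_(i < m) A i ^+ (#|F| ^ ord_pred i).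

End EvasiveSubspace.

(* Main.v *)
(* Suppose that h + 3 vectors Vfun x_s, linearly independent over F, lie in an
   L-subspace of dimension h + 1. Let S be the m x (h + 3) matrix with columns
   x_s, and let T_j be the span of the rows of S, S^q, ..., S^(q^(j-1)). The
   matrix C with columns Vfun x_s has rank at most h + 1 and its row space
   contains T_h. A subspace stable under the Frobenius map is defined over F,
   so by independence of the x_s the dimension of T_j grows strictly until it
   reaches h + 3; moreover, its increments do not increase with j.
   If rank S >= 2, then T_h is the row space of C and the rows of C built
   from the f_i show that T_{h+1} is Frobenius-stable, hence of dimension h + 3,
   whereas T_{h-1} and T_h have dimensions at least h and exactly h + 1, which
   contradicts the concavity.
   If rank S = 1, then row i of S is lam_i u with u, u^q, ..., u^(q^(h+1))
   independent, so modulo T_h the rows of C built from the f_i span at most a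
   line. This gives mu_i = c alpha_{i+1} mu_{i+1}^q for mu_i = lam_i^(q^h), and
   going once around the cycle makes K a (1 + q + ... + q^(m-1))-th power. *)
From HB Require Import structures.
Require Import Defs.
From mathcomp Require Import all_boot all_algebra all_field.
From mathcomp Require Import zify ring.

Set Implicit Arguments.
Unset Strict Implicit.
Unset Printing Implicit Defensive.

Import GRing.Theory.
Local Open Scope ring_scope.

(** * Frobenius maps and their fixed points *)

Section FrobeniusSpans.
Variables (F : finFieldType) (L : fieldExtType F).

Definition frob j (x : L) := x ^+ (#|F| ^ j).

Fact frob_is_zmod_morphism j : zmod_morphism (frob j).
Proof.
move=> x y; rewrite /frob addrC -scaleN1r (Frobenius_linear j).
by rewrite scaleN1r addrC.
Qed.

Fact frob_is_monoid_morphism j : monoid_morphism (frob j).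
Proof. by split=> [|x y]; rewrite /frob (expr1n, exprMn). Qed.

HB.instance Definition _ j :=
  GRing.isZmodMorphism.Build L L (frob j) (frob_is_zmod_morphism j).
HB.instance Definition _ j :=
  GRing.isMonoidMorphism.Build L L (frob j) (frob_is_monoid_morphism j).

Lemma frobS j x : frob 1 (frob j x) = frob j.+1 x.
Proof. by rewrite /frob -exprM expn1 -expnSr. Qed.

(** The polynomial X^q - X already splits over [F] as the product of the X - c, so it has no further
    root in [L]. *)
Lemma frob1_fixed x : frob 1 x = x -> exists c : F, x = c%:A.
Proof.
rewrite /frob expn1 => xq; pose g := (in_alg L).
have /rootP : root (map_poly g ('X^#|F| - 'X)) x.
  by rewrite rmorphB /= map_polyXn map_polyX /root !hornerE xq subrr.
rewrite finField_genPoly rmorph_prod /= horner_prod => /eqP.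
rewrite prodf_seq_eq0 => /hasP[c _ /=].
by rewrite rmorphB /= map_polyX map_polyC !hornerE subr_eq0 => /eqP ->; exists c.
Qed.

(** * Row spaces spanned by Frobenius powers *)

Section Span.
Variables (m N : nat) (S : 'M[L]_(m, N)).

(* A vector of minimal weight in the kernel of T, scaled to have an entry 1,
   is fixed by the Frobenius map. *)
Lemma frob_stable_kernel (T : 'M[L]_N) :
    (map_mx (frob 1) T <= T)%MS -> ~~ row_full T ->
  exists2 c : 'rV[F]_N, c != 0 & map_mx (in_alg L) c *m T^T = 0.
Proof.
move=> sT nfT.
(* The Frobenius map preserves rank, so the inclusion [sT] is an equality. *)
have /submxP[D TD] : (T <= map_mx (frob 1) T)%MS.
  by have := mxrank_leqif_sup sT; rewrite mxrank_map => -[_ <-].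
have kerS (v : 'rV_N) : v *m T^T = 0 -> map_mx (frob 1) v *m T^T = 0.
  move=> vT; rewrite TD trmx_mul mulmxA map_trmx -map_mxM vT.
  by rewrite map_mx0 mul0mx.
have : kermx T^T != 0.
  by rewrite kermx_eq0 /row_free mxrank_tr.
case/rowV0Pn=> v /sub_kermxP vT v0.
have [w] := ubnP #|[set s | v 0 s != 0]|.
elim: w v vT v0 => // w IHw v vT v0 /ltnSE lew.
have /existsP[s vs0] : [exists s, v 0 s != 0].
  apply: contraR v0 => /existsPn v0; apply/eqP/rowP=> s.
  by rewrite mxE; apply/eqP; have := v0 s; rewrite negbK.
pose v' := (v 0 s)^-1 *: v.
have v'T : v' *m T^T = 0 by rewrite -scalemxAl vT scaler0.
have v's : v' 0 s = 1 by rewrite mxE mulVf.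
have [v'F|v'F] := eqVneq (map_mx (frob 1) v') v'.
  have fixc t : exists c : F, v' 0 t == c%:A.
    have /rowP/(_ t) := v'F; rewrite mxE => /frob1_fixed[c ->].
    by exists c.
  pose c : 'rV[F]_N := \row_t xchoose (fixc t).
  have cv : map_mx (in_alg L) c = v'.
    apply/rowP=> t; rewrite mxE [c _ _]mxE.
    exact/esym/eqP/(xchooseP (fixc t)).
  exists c; last by rewrite cv.
  apply: contra_eq_neq v's => c0.
  by rewrite -cv c0 map_mx0 mxE eq_sym oner_neq0.
(* The difference vanishes wherever [v] does, and also at [s], where [v'] is 1: its weight is
   smaller. *)
apply: (IHw (map_mx (frob 1) v' - v')); rewrite ?subr_eq0 //.
  by rewrite mulmxBl kerS // v'T subrr.
apply: leq_trans lew; apply/proper_card/properP; split.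
  apply/subsetP=> t; rewrite !inE; apply: contraNneq => vt.
  by rewrite !mxE vt mulr0 rmorph0 subrr.
by exists s; rewrite !inE // !mxE mulVf // rmorph1 subrr eqxx.
Qed.

(** This is T_j; [<<_>>] makes the summands square, so that they can be iterated. *)
Definition frob_span j : 'M[L]_N := (\sum_(i < j) <<map_mx (frob i) S>>)%MS.

Lemma frob_spanS j :
  (frob_span j.+1 :=: frob_span j + map_mx (frob j) S)%MS.
Proof.
rewrite /frob_span big_ord_recr /=.
exact: adds_eqmx (eqmx_refl _) (genmxE _).
Qed.

Lemma frob_span_leS j : (frob_span j <= frob_span j.+1)%MS.
Proof. by rewrite frob_spanS addsmxSl. Qed.

Lemma frob_span1 : (frob_span 1 :=: S)%MS.
Proof.
have S0 : map_mx (frob 0) S = S.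
  by apply/matrixP=> i s; rewrite mxE /frob expn0 expr1.
apply: eqmx_trans (frob_spanS 0) _.
rewrite /frob_span big_ord0 S0; exact: adds0mx.
Qed.

Lemma frob_span_frob j :
  (frob_span j.+1 :=: S + map_mx (frob 1) (frob_span j))%MS.
Proof.
elim: j => [|j IHj].
  rewrite [frob_span 0]/frob_span big_ord0 map_mx0.
  by apply: eqmx_trans frob_span1 _; apply/eqmx_sym; apply: addsmx0.
apply: eqmx_trans (frob_spanS _) _.
apply: eqmx_trans (adds_eqmx IHj (eqmx_refl _)) _.
rewrite -addsmxA; apply: adds_eqmx (eqmx_refl _) _.
have -> : map_mx (frob j.+1) S = map_mx (frob 1) (map_mx (frob j) S).
  by apply/matrixP=> i s; rewrite !mxE frobS.
apply/eqmx_sym; apply: eqmx_trans (map_addsmx _ _ _).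
by apply/eqmxP; rewrite !map_submx; apply/eqmxP; apply: frob_spanS.
Qed.

Lemma sub_frob_span j : (S <= frob_span j.+1)%MS.
Proof. by rewrite frob_span_frob addsmxSl. Qed.

Lemma frob_sub_frob_span j :
  (map_mx (frob 1) (frob_span j) <= frob_span j.+1)%MS.
Proof. by rewrite frob_span_frob addsmxSr. Qed.

(** T_{j+2} lies in the sum of T_{j+1} and its Frobenius image, whose intersection contains the
    Frobenius image of T_j. *)
Lemma rank_frob_span_concave j :
  (\rank (frob_span j.+2) + \rank (frob_span j) <= (\rank (frob_span j.+1)).*2)%N.
Proof.
rewrite -addnn -[in X in (_ <= _ + X)%N](mxrank_map (frob 1)) -[leqRHS]mxrank_sum_cap.
apply: leq_add; last first.
  rewrite -[leqLHS](mxrank_map (frob 1)); apply: mxrankS.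
  by rewrite sub_capmx frob_sub_frob_span map_submx frob_span_leS.
apply: mxrankS; rewrite frob_span_frob; apply: addsmxS => //.
exact: sub_frob_span.
Qed.

Hypothesis S_free :
  forall c : 'rV[F]_N, map_mx (in_alg L) c *m S^T = 0 -> c = 0.

(** Otherwise a nonzero vector over [F] would kill [T], hence also [S]. *)
Lemma frob_stable_full (T : 'M[L]_N) :
  (S <= T)%MS -> (map_mx (frob 1) T <= T)%MS -> row_full T.
Proof.
move=> /submxP[D SD] sT; apply: contraT => /(frob_stable_kernel sT)[c c0 cT].
by case/eqP: c0; apply: S_free; rewrite SD trmx_mul mulmxA cT mul0mx.
Qed.

Lemma frob_span_full j : (frob_span j.+2 <= frob_span j.+1)%MS ->
  \rank (frob_span j.+1) = N.
Proof.
move=> st; apply/eqP/frob_stable_full; first exact: sub_frob_span.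
exact: submx_trans (frob_sub_frob_span _) st.
Qed.

Lemma rank_frob_span j : (minn N (\rank S + j) <= \rank (frob_span j.+1))%N.
Proof.
elim: j => [|j IHj]; first by rewrite addn0 frob_span1 geq_minr.
have [st|nst] := boolP (frob_span j.+2 <= frob_span j.+1)%MS.
  apply: leq_trans (mxrankS (frob_span_leS _)).
  by rewrite (frob_span_full st) geq_minl.
have lt : (frob_span j.+1 < frob_span j.+2)%MS by rewrite /ltmx frob_span_leS.
by have := rank_ltmx lt; lia.
Qed.

End Span.

(** * The recurrence around the cycle *)

Lemma cyclic_recurrence_power m (A mu : 'I_m -> L) c :
    (forall i, mu i = c * A (ordS i) * frob 1 (mu (ordS i))) ->
    (exists i, mu i != 0) ->
  exists y : L, y ^+ (\sum_(j < m) #|F| ^ j)%N = K_ A.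
Proof.
move=> muE [i0 mu0].
have m_gt0 : (0 < m)%N by apply: leq_ltn_trans (ltn_ord i0).
pose o := Ordinal m_gt0; pose e t := iter t (@ordS m) o.
have e_mod t : e t = (t %% m)%N :> nat.
  by elim: t => [|t IHt]; rewrite ?mod0n //= IHt -addn1 modnDml addn1.
have e_ord (i : 'I_m) : e i = i by apply: ord_inj; rewrite e_mod modn_small.
have e_m : e m = o by apply: ord_inj; rewrite e_mod modnn.
(* The recurrence unrolled [t] times; at [t = m] it returns to [mu o], and the product of the [A] is
   [K_ A]. *)
have muo t : mu o = c ^+ (\sum_(j < t) #|F| ^ j)
    * (\prod_(j < t) A (e j.+1) ^+ (#|F| ^ j)) * frob t (mu (e t)).
  elim: t => [|t IHt]; first by rewrite !big_ord0 mulr1 mul1r /frob expr1.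
  rewrite {}IHt [mu (e t)]muE !big_ord_recr /= exprD 2!rmorphM /=.
  rewrite -[frob t.+1 _]frobS /frob expn1 -!exprM [(_ * #|F|)%N]mulnC -!mulrA.
  by congr (_ * _); rewrite mulrCA; congr (_ * _); rewrite mulrCA.
(* A zero of [mu] propagates to the preceding index, so nonvanishing travels forward from [i0] to
   [e m], which is [o]. *)
have muo0 : mu o != 0.
  rewrite -e_m -(subnK (ltnW (ltn_ord i0))).
  elim: (m - i0)%N => [|t]; first by rewrite add0n e_ord.
  by apply: contra_neq => mu_t; rewrite muE /= mu_t rmorph0 mulr0.
have KE : K_ A = \prod_(j < m) A (e j.+1) ^+ (#|F| ^ j).
  rewrite /K_ (reindex_inj (bij_inj (@ordS_bij m))); apply: eq_bigr => j _.
  by rewrite ordSK (_ : e j.+1 = ordS j) //; congr (ordS _); apply: e_ord.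
have /eqP := muo m; rewrite -KE e_m.
(* With s the required exponent, q^m - 1 = (q - 1) s, so cancelling [mu o] leaves 1 = K (c
   mu_o^(q-1))^s. *)
have qm : (#|F| ^ m = (#|F|.-1 * \sum_(j < m) #|F| ^ j).+1)%N.
  by rewrite -predn_exp prednK // expn_gt0 (ltnW (finNzRing_gt1 F)).
rewrite /frob qm exprS mulrCA -[X in X == _]mulr1 => /eqP/(mulfI muo0).
rewrite exprM mulrAC -exprMn => /esym E.
exists (c * mu o ^+ #|F|.-1)^-1.
rewrite exprVn -[LHS]mulr1 -[X in _ * X]E mulKf //.
by apply: contra_eq_neq E => ->; rewrite mul0r eq_sym oner_neq0.
Qed.

(** * The cases rank S >= 2 and rank S = 1 *)

Section RankBound.
Variables (m h p : nat) (A : 'I_m -> L).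
Variables (S : 'M[L]_(m, h.+3)) (C : 'M[L]_(p, h.+3)).
Hypothesis S_free :
  forall c : 'rV[F]_h.+3, map_mx (in_alg L) c *m S^T = 0 -> c = 0.
Hypothesis rankC : (\rank C <= h.+1)%N.
Hypothesis powC : forall j, (j < h)%N -> (map_mx (frob j) S <= C)%MS.
Hypothesis fC : forall i, ((map_mx (frob h) (row i S) +
  A (ordS i) *: map_mx (frob h.+1) (row (ordS i) S))%R <= C)%MS.

Lemma frob_span_sub : (frob_span S h <= C)%MS.
Proof. by apply/sumsmx_subP=> i _; rewrite genmxE; apply: powC. Qed.

Lemma rank_S_le1 : (2 <= h)%N -> (forall i, A i != 0) -> (\rank S <= 1)%N.
Proof.
move=> h2 A0; rewrite leqNgt; apply/negP=> rS.
have rT j : (0 < j)%N ->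
    (minn h.+3 (\rank S + j.-1) <= \rank (frob_span S j))%N.
  by case: j => // j _; apply: rank_frob_span.
have CT : (C <= frob_span S h)%MS.
  rewrite -(geq_leqif (mxrank_leqif_sup frob_span_sub)).
  by have := rT h; lia.
have full : \rank (frob_span S h.+1) = h.+3.
  apply: frob_span_full S_free _ _.
  (* Row [k] of S^(q^(h+1)) comes from the row of [C] built from f at [ord_pred k], after division
     by [A k]. *)
  rewrite frob_spanS addsmx_sub submx_refl; apply/row_subP=> k.
  have <- : ordS (ord_pred k) = k by rewrite ord_predK.
  set i := ord_pred k.
  have uT : (map_mx (frob h) (row i S) <= frob_span S h.+1)%MS.
    rewrite frob_spanS map_row.
    exact: submx_trans (row_sub _ _) (addsmxSr _ _).
  rewrite -map_row -(eqmx_scale _ (A0 (ordS i))).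
  rewrite -[X in (X <= _)%MS](addKr (map_mx (frob h) (row i S))).
  apply: addmx_sub; first by rewrite eqmx_opp.
  exact: submx_trans (submx_trans (fC i) CT) (frob_span_leS _ _).
(* Concavity would give (h + 3) + h <= 2 (h + 1); the bound h on the rank of T_{h-1} needs h >=
   2. *)
have := rank_frob_span_concave S h.-1; rewrite prednK ?(ltnW h2) // full.
have := rT h.-1; have := mxrankS frob_span_sub.
by lia.
Qed.

Lemma K_power_of_rank_le1 : (forall i, A i != 0) -> (\rank S <= 1)%N ->
  exists y : L, y ^+ (\sum_(j < m) #|F| ^ j)%N = K_ A.
Proof.
move=> A0 rS.
have [i0 Si0] : exists i0, row i0 S != 0.
  apply/existsP; apply: contraT => /existsPn S0.
  have {}S0 : S = 0.
    by apply/row_matrixP=> i; rewrite row0; apply/eqP; rewrite -[_ == _]negbK.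
  have /rowP/(_ 0)/eqP : const_mx 1 = 0 :> 'rV[F]_h.+3.
    by apply: S_free; rewrite S0 trmx0 mulmx0.
  by rewrite !mxE oner_eq0.
set u := row i0 S in Si0.
have Su : (S <= u)%MS.
  rewrite -(geq_leqif (mxrank_leqif_sup (row_sub i0 S))).
  by rewrite (leq_trans rS) // lt0n mxrank_eq0.
have lamP i : exists a, row i S == a *: u.
  have /sub_rVP[a ->] : (row i S <= u)%MS by apply: submx_trans (row_sub _ _) Su.
  by exists a.
pose lam i := xchoose (lamP i).
have lamE i : row i S = lam i *: u := eqP (xchooseP (lamP i)).
pose mu i := frob h (lam i); pose nu i := A (ordS i) * frob 1 (mu (ordS i)).
have wC i :
    ((mu i *: map_mx (frob h) u + nu i *: map_mx (frob h.+1) u)%R <= C)%MS.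
  by have := fC i; rewrite !lamE !map_mxZ /= scalerA /nu frobS.
(* If this determinant were nonzero, Cramer's rule would put both Frobenius powers of [u] in [C],
   hence also T_{h+2}, whose rank is at least h + 2. *)
have detZ i k : mu i * nu k = mu k * nu i.
  apply: contraTeq isT => det0.
  have uhC : (map_mx (frob h) u <= C)%MS.
    rewrite -(eqmx_scale _ (_ : mu i * nu k - mu k * nu i != 0)) ?subr_eq0 //.
    have := addmx_sub (scalemx_sub (nu k) (wC i)) (scalemx_sub (- nu i) (wC k)).
    congr (_ <= _)%MS; apply/rowP=> t; rewrite !mxE; ring.
  have uh1C : (map_mx (frob h.+1) u <= C)%MS.
    rewrite -(eqmx_scale _ (_ : mu i * nu k - mu k * nu i != 0)) ?subr_eq0 //.
    have := addmx_sub (scalemx_sub (- mu k) (wC i)) (scalemx_sub (mu i) (wC k)).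
    congr (_ <= _)%MS; apply/rowP=> t; rewrite !mxE; ring.
  have mapC j : (map_mx (frob j) u <= C)%MS -> (map_mx (frob j) S <= C)%MS.
    by apply: submx_trans; rewrite map_submx.
  have : (frob_span S h.+2 <= C)%MS.
    rewrite frob_spanS addsmx_sub mapC // andbT.
    by rewrite frob_spanS addsmx_sub mapC // frob_span_sub.
  have rS_gt0 : (0 < \rank S)%N.
    by apply: leq_trans (mxrankS (row_sub i0 S)); rewrite lt0n mxrank_eq0.
  by move/mxrankS; have := rank_frob_span S_free h.+1; lia.
have mu0 : mu i0 != 0.
  rewrite fmorph_eq0; apply: contra_neq Si0 => lam0.
  by rewrite /u lamE lam0 scale0r.
pose k := ord_pred i0.
have nu0 : nu k != 0 by rewrite mulf_neq0 // ord_predK fmorph_eq0.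
(* By [detZ], [mu] is proportional to [nu]; the constant is read at [k], where [nu] is nonzero. *)
apply: (@cyclic_recurrence_power m A mu (mu k / nu k)); last by exists i0.
move=> i; rewrite -mulrA -[_ * frob _ _]/(nu i).
by apply: (mulIf nu0); rewrite mulrAC divfK // detZ.
Qed.
End RankBound.
End FrobeniusSpans.

(** * From subspaces to matrices, and the theorem *)

Lemma rank_evalmx (F : finFieldType) (L : fieldExtType F) k N
    (H : {vspace {ffun 'I_k -> L^o}}) (b : 'I_N -> {ffun 'I_k -> L}) :
    (forall s, (b s : {ffun 'I_k -> L^o}) \in H) ->
  (\rank (\matrix_(t < k, s < N) b s t : 'M[L]_(k, N)) <= \dim H)%N.
Proof.
move=> bH; pose w := vbasis H.
pose B : 'M[L]_(k, \dim H) := \matrix_(t, j) (w`_j : {ffun 'I_k -> L}) t.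
pose D : 'M[L]_(\dim H, N) := \matrix_(j, s) coord w j (b s).
(* Coordinates in a basis of [H] factor the matrix through dimension [\dim H]. *)
rewrite (_ : (\matrix_(t, s) _) = B *m D) ?mulmx_max_rank //.
apply/matrixP=> t s; rewrite !mxE [in LHS](coord_vbasis (bH s)) sum_ffunE.
by apply: eq_bigr => j _; rewrite !mxE ffunE mulrC.
Qed.

Theorem theorem3p5 (F : finFieldType) (L : fieldExtType F) (q n m h : nat)
    (A : 'I_m -> L) (hq : #|F| = q) (hn : \dim {: L} = n)
    (hm : (3 <= m)%N) (h2 : (2 <= h)%N) (hhn : (h <= n - 2)%N)
    (hA : forall i, A i != 0)
    (hK : ~ exists y : L, y ^+ (\sum_(j < m) q ^ j)%N = K_ A) :
  evasive h.+1 h.+2 (V_ h A).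
Proof.
move=> H dimH; rewrite leqNgt; apply/negP; set U := (_ :&: _)%VS => dimU.
have size_b : size (take h.+3 (vbasis U)) == h.+3.
  by rewrite size_takel // size_tuple.
pose b := Tuple size_b.
have b_free : free b.
  apply: (catl_free (Y := drop h.+3 (vbasis U))).
  by rewrite /= cat_take_drop (basis_free (vbasisP U)).
have bU s : b`_s \in U.
  have [lts|ges] := ltnP s h.+3; last by rewrite nth_default ?mem0v // (eqP size_b).
  by rewrite nth_take // vbasis_mem // mem_nth // size_tuple (leq_trans lts).
have /fin_all_exists[x xb] (s : 'I_h.+3) : exists y, b`_s = Vfun h A y.
  by have /memv_capP[/mem_V] := bU s.
pose S : 'M[L]_(m, h.+3) := \matrix_(i, s) x s i.
pose C : 'M[L]_(h.+1 * m, h.+3) := \matrix_(t, s) Vfun h A (x s) t.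
have rowC (j : 'I_h.+1) i : row (mxvec_index j i) C =
    \row_s if (j < h)%N then x s i ^+ (#|F| ^ j) else f_ h A (x s) i.
  by apply/rowP=> s; rewrite !mxE ffunE mxvecE mxE.
(* By linearity of [Vfun], a relation over [F] between the [x s] is one between the free vectors
   [b]. *)
have S_free (c : 'rV[F]_h.+3) : map_mx (in_alg L) c *m S^T = 0 -> c = 0.
  move=> cS; apply/rowP=> s; rewrite mxE.
  apply: (freeP b_free (fun s => c 0 s)).
  have -> : \sum_s c 0 s *: b`_s = Vfun h A (\sum_s c 0 s *: x s).
    by rewrite linear_sum; apply: eq_bigr => t _; rewrite linearZ xb.
  rewrite -[RHS](linear0 (Vfun h A)); congr (Vfun h A _).
  apply/ffunP=> i; rewrite sum_ffunE ffunE.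
  have /rowP/(_ i) := cS; rewrite !mxE; apply: etrans.
  by apply: eq_bigr => t _; rewrite !mxE ffunE mulr_algl.
have rankC : (\rank C <= h.+1)%N.
  rewrite -[leqRHS]dimH; apply: rank_evalmx => s; rewrite -mem_restrict_scalars -xb.
  by have /memv_capP[] := bU s.
have powC j : (j < h)%N -> (map_mx (frob j) S <= C)%MS.
  move=> ltj; apply/row_subP=> i.
  have := row_sub (mxvec_index (Ordinal (ltnW ltj : (j < h.+1)%N)) i) C.
  rewrite rowC /= ltj; congr (_ <= _)%MS.
  by apply/rowP=> s; rewrite !mxE.
have fC i : ((map_mx (frob h) (row i S) +
    A (ordS i) *: map_mx (frob h.+1) (row (ordS i) S))%R <= C)%MS.
  have := row_sub (mxvec_index ord_max i) C.
  rewrite rowC /= ltnn; congr (_ <= _)%MS.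
  by apply/rowP=> s; rewrite !mxE.
apply: hK; rewrite -hq.
apply: (K_power_of_rank_le1 S_free rankC powC fC hA).
exact: (rank_S_le1 S_free rankC powC fC h2 hA).
Qed.
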